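(* Let $K$ be a convex set in $\mathbb{R}^n$. Suppose that $c\colon K\times K\to\mathbb{R}$ is a continuous function. Let $f$ be a continuous function on the disjoint union $K\cup K$ of two copies of $K$. Let $x\in K$. The following conditions are equivalent: (i) for all $x_1,\dotsc,x_{n+1}\in K$ and all non-negative $\lambda_1,\dotsc,\lambda_{n+1}$ that sum up to one and such that $x=\sum_{i=1}^{n+1}\lambda_ix_i$ there is $$f_1(x)-\sum_{i=1}^{n+1}\lambda_i f_2(x_i)\leq\sum_{i=1}^{n+1}\lambda_ic\Big(\sum_{j=1}^{n+1}\lambda_jx_j,x_i\Big);$$ (ii) there exists $\gamma\in\mathbb{R}^n$ such that for all $y\in K$ in the minimal face of $K$ that contains $x$ we have $$f_1(x)-f_2(y)\leq c(x,y)+\langle \gamma, y-x\rangle;$$ (iii) for any bounded random variable $X$ with values in $K$ and barycentre $x$ there is $$\mathbb{E}\big( f_1(x)-f_2(X)\big)\leq \mathbb{E}c(x,X).$$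
   Context: For a function $f$ on the disjoint union of two copies of $K$, $f_1$ and $f_2$ denote its restrictions to the first and second copy of $K$, respectively. A set $F\subset K$ is a face of $K$ if for any $z\in F$ and any $t\in(0,1)$ such that $z=tx+(1-t)y$ for some $x,y\in K$ we have $x,y\in F$. For each $x\in K$ there is a unique minimal face of $K$ containing $x$ (the intersection of all faces containing $x$). A random variable $X$ has barycentre $x$ if $\mathbb{E}X=x$. *)

(* Defs.v *)
From HB Require Import structures.
From mathcomp Require Import all_boot all_order all_algebra.
From mathcomp Require Import all_classical all_reals all_analysis.

Set Implicit Arguments.
Unset Strict Implicit.
Unset Printing Implicit Defensive.

Import Order.TTheory GRing.Theory Num.Theory.
Import numFieldNormedType.Exports.

Local Open Scope classical_set_scope.
Local Open Scope ring_scope.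

Definition dotp (R : realType) (n : nat) (u v : 'rV[R]_n) : R :=
  \sum_(i < n) u ord0 i * v ord0 i.

(* T + T with the coproduct topology; [false] indexes the first copy. *)
Definition two_copies (T : topologicalType) : topologicalType :=
  {b : bool & (fun=> T) b}.

Definition disjoint_double (T : topologicalType) (K : set T) :
    set (two_copies T) :=
  [set p | K (projT2 p)].

Definition first_copy (T : topologicalType) (U : Type)
    (f : two_copies T -> U) (y : T) : U := f (existT (fun=> T) false y).

Definition second_copy (T : topologicalType) (U : Type)
    (f : two_copies T -> U) (y : T) : U := f (existT (fun=> T) true y).

(* No convexity of F is required. *)
Definition is_face (R : realType) (n : nat) (K F : set 'rV[R]_n) : Prop :=
  F `<=` K /\
  forall (z x y : 'rV[R]_n) (t : R), F z -> K x -> K y -> 0 < t < 1 ->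
    z = t *: x + (1 - t) *: y -> F x /\ F y.

Definition minimal_face (R : realType) (n : nat) (K : set 'rV[R]_n)
    (x : 'rV[R]_n) : set 'rV[R]_n :=
  \bigcap_(F in [set F | is_face K F /\ F x]) F.

Definition borel_rV (R : realType) (n : nat) :=
  g_sigma_algebraType (@open 'rV[R]_n).

(* Each coordinate of a bounded random vector is integrable, so the
   expectations below are genuine in that case. *)
Definition has_barycentre d (T : measurableType d) (R : realType) (n : nat)
    (P : probability T R) (X : T -> 'rV[R]_n) (x : 'rV[R]_n) : Prop :=
  forall i : 'I_n, ('E_P[fun w => X w ord0 i] = (x ord0 i)%:E)%E.

(* The expectation of Y exists as an extended real number.  The library's
   ['E_P[Y]] is total, with an arbitrary value when this fails. *)
Definition has_expectation d (T : measurableType d) (R : realType)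
    (P : probability T R) (Y : T -> R) : Prop :=
  ('E_P[(Y^\+)%R] < +oo)%E \/ ('E_P[(Y^\-)%R] < +oo)%E.

(* Main.v *)
Require Import Defs.
From HB Require Import structures.
From mathcomp Require Import all_boot all_order all_algebra.
From mathcomp Require Import all_classical all_reals all_analysis.
From mathcomp Require Import measurable_realfun.
From mathcomp Require Import ring lra.

Set Implicit Arguments.
Unset Strict Implicit.
Unset Printing Implicit Defensive.

Import Order.TTheory GRing.Theory Num.Theory.
Import numFieldNormedType.Exports.

Local Open Scope classical_set_scope.
Local Open Scope ring_scope.

(** Put [h y = c x y + f2 y - f1 x].  A finite-dimensional convex cone either is
    a subspace or lies in a half-space whose boundary does not contain it.
    Under (i), Caratheodory's reduction shows that the cone generated by the
    [(y - x, s)], with [y] in the minimal face and [h y <= s], omits [(0, -1)];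
    a half-space containing it has [gamma] as its slope and is not vertical,
    because the minimal face spans a subspace of directions at [x].  For (iii),
    the same alternative, applied repeatedly inside the smallest subspace
    carrying [X - x], shows that [X] lies almost surely in the minimal face, and
    integrating (ii) removes the linear term.  Laws with finite support give
    (i) back from (iii). *)

(** * Linearity of the dot product *)

Section dotp.
Context (R : realType) (n : nat).
Implicit Types u v w : 'rV[R]_n.

Lemma dotpZr u k v : dotp u (k *: v) = k * dotp u v.
Proof. by rewrite /dotp mulr_sumr; apply: eq_bigr => i _; rewrite mxE mulrCA. Qed.

Lemma dotp0r u : dotp u 0 = 0.
Proof. by rewrite -(scale0r 0) dotpZr mul0r. Qed.

Lemma dotpNr u v : dotp u (- v) = - dotp u v.
Proof. by rewrite -scaleN1r dotpZr mulN1r. Qed.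

Lemma dotpZl u k v : dotp (k *: u) v = k * dotp u v.
Proof. by rewrite /dotp mulr_sumr; apply: eq_bigr => i _; rewrite mxE mulrA. Qed.

Lemma dotp_sumr (I : finType) u (a : I -> 'rV[R]_n) :
  dotp u (\sum_i a i) = \sum_i dotp u (a i).
Proof.
rewrite /dotp exchange_big; apply: eq_bigr => i _.
by rewrite summxE mulr_sumr.
Qed.

Lemma dotp_mulmx u v : (v *m u^T) 0 0 = dotp u v.
Proof. by rewrite mxE; apply: eq_bigr => i _; rewrite mxE mulrC. Qed.

End dotp.

(** * Separation for convex cones in finite dimension *)

Section convex_cones.
Context (R : realType).

Definition convex_cone m (C : set 'rV[R]_m) :=
  [/\ C 0, (forall u v, C u -> C v -> C (u + v)) &
      (forall k v, 0 <= k -> C v -> C (k *: v))].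

Lemma convex_cone_opp_lt0 m (C : set 'rV[R]_m) (b : 'rV[R]_m) (k : R) :
  convex_cone C -> k < 0 -> C (k *: b) -> C (- b).
Proof.
move=> [C0 CD CZ] k0 Ckb; have -> : - b = (- k^-1) *: (k *: b).
  by rewrite scalerA mulNr mulVf ?scaleN1r// lt_eqF.
by apply: CZ => //; rewrite oppr_ge0 invr_le0 ltW.
Qed.

(** One Hahn-Banach step. Here [b] is an order unit and [a] is the infimum of the [t] with
    [t *: b - v] in [C]. Adding the line through [v - a *: b] identifies [v] with [a *: b], and the
    choice of [a] keeps [- b] outside. *)
Lemma cone_add_line m (C : set 'rV[R]_m) (b v : 'rV[R]_m) :
  convex_cone C -> (forall u, exists t, C (t *: b - u)) -> ~ C (- b) ->
  exists C' : set 'rV[R]_m, exists a : R, [/\ convex_cone C', C `<=` C', ~ C' (- b),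
    C' (v - a *: b) & C' (a *: b - v)].
Proof.
move=> coneC unitb Nb; have [C0 CD CZ] := coneC.
pose S := [set t | C (t *: b - v)].
have infS : has_inf S.
  split; first by have [t ?] := unitb v; exists t.
  (* An element of [S] below [- t'] would put a negative multiple of [b] into [C]. *)
  have [t' Ct'] := unitb (- v); exists (- t') => t St.
  rewrite leNgt; apply/negP => tt'; apply: Nb.
  apply: (@convex_cone_opp_lt0 _ _ b (t + t')) => //.
    by rewrite -(subrr t') addrC ltrD2l.
  have := CD _ _ St Ct'; congr C.
  by rewrite opprK addrACA addNr addr0 scalerDl.
exists [set u | exists s, C (u + s *: (v - inf S *: b))], (inf S); split.
- split; first by exists 0; rewrite scale0r addr0.
    move=> u w [s Cs] [t Ct]; exists (s + t).
    by rewrite scalerDl addrACA; exact: CD.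
  move=> k u k0 [s Cs]; exists (k * s).
  by rewrite -scalerA -scalerDr; exact: CZ.
- by move=> u Cu; exists 0; rewrite scale0r addr0.
- move=> [s Cs]; have [s0|s0|s0] := ltgtP s 0.
  (* Scaling by [- s^-1] produces an element of [S] below its infimum. *)
  + have sn0 : s != 0 by rewrite lt_eqF.
    have : S (inf S + s^-1).
      have := CZ (- s^-1) _ _ Cs.
      rewrite oppr_ge0 invr_le0 (ltW s0) => /(_ isT); congr C.
      by apply/rowP => i; rewrite !mxE; field.
    by move=> /(ge_inf infS.2); apply/negP; rewrite -ltNge gtrDl invr_lt0.
  (* Some [t] in [S] is less than [inf S + s^-1]; adding the two cone elements cancels [v] and
     leaves a negative multiple of [b]. *)
  + have sn0 : s != 0 by rewrite gt_eqF.
    have : inf S < inf S + s^-1 by rewrite ltrDl invr_gt0.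
    move=> /(inf_lt infS.1)[t St ts]; apply: Nb.
    apply: (@convex_cone_opp_lt0 _ _ b (t - inf S - s^-1)) => //; first lra.
    have := CD _ _ St (CZ s^-1 _ _ Cs).
    rewrite invr_ge0 (ltW s0) => /(_ isT); congr C.
    by apply/rowP => i; rewrite !mxE; field.
  + by move: Cs; rewrite s0 scale0r addr0.
- by exists (-1); rewrite scaleN1r subrr.
- by exists 1; rewrite scale1r addrA subrK subrr.
Qed.

Lemma cone_add_lines m (C : set 'rV[R]_m) (b : 'rV[R]_m) (s : seq 'rV[R]_m) :
  convex_cone C -> (forall u, exists t, C (t *: b - u)) -> ~ C (- b) ->
  exists C' : set 'rV[R]_m, [/\ convex_cone C', C `<=` C', ~ C' (- b) &
    forall v, v \in s -> exists a, C' (v - a *: b) /\ C' (a *: b - v)].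
Proof.
elim: s C => [|v s IHs] C coneC unitb Nb; first by exists C; split.
have [C1 [a [cone1 CC1 Nb1 va av]]] := cone_add_line v coneC unitb Nb.
have unit1 u : exists t, C1 (t *: b - u).
  by have [t Ct] := unitb u; exists t; exact: CC1.
have [C2 [cone2 C12 Nb2 C2s]] := IHs _ cone1 unit1 Nb1.
exists C2; split => //; first exact: subset_trans C12.
move=> w; rewrite inE => /orP[/eqP ->|]; last exact: C2s.
by exists a; split; apply: C12.
Qed.

(** In the enlarged cone each basis vector equals a multiple of [b] modulo the lineality space. By
    linearity so does every vector, and that multiple is the value of the functional. *)
Lemma order_unit_functional m (C : set 'rV[R]_m) (b : 'rV[R]_m) :
  convex_cone C -> (forall u, exists t, C (t *: b - u)) -> ~ C (- b) ->
  exists l : 'rV[R]_m, (forall v, C v -> 0 <= dotp l v) /\ dotp l b = 1.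
Proof.
move=> coneC unitb Nb.
have [C' [cone' CC' Nb' C's]] :=
  cone_add_lines [seq delta_mx 0 i | i : 'I_m] coneC unitb Nb.
have [C0 CD CZ] := cone'.
have /choice[a Ca] : forall i : 'I_m, exists a,
    C' (delta_mx 0 i - a *: b) /\ C' (a *: b - delta_mx 0 i).
  by move=> i; apply: C's; apply: map_f; rewrite mem_enum.
pose l : 'rV[R]_m := \row_i a i.
have vE (v : 'rV[R]_m) :
    v - dotp l v *: b = \sum_i v 0 i *: (delta_mx 0 i - a i *: b).
  rewrite {1}(row_sum_delta v) /dotp scaler_suml -sumrB.
  apply: eq_bigr => i _; rewrite scalerBr scalerA mxE.
  by rewrite [_ * v _ _]mulrC ord1.
have Cv v : C' (v - dotp l v *: b).
  rewrite vE; apply: (big_ind C') => // i _.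
  have [vi|vi] := lerP 0 (v 0 i); first exact: CZ (Ca i).1.
  by rewrite -(opprK (_ *: _)) -scalerN -scaleNr opprB; apply: CZ (Ca i).2; lra.
have Cv' v : C' (dotp l v *: b - v).
  by have := Cv (- v); rewrite dotpNr scaleNr opprK addrC.
exists l; split=> [v /CC' C'v|].
  rewrite leNgt; apply/negP => lv0; apply: Nb'.
  apply: convex_cone_opp_lt0 lv0 _ => //.
  by have := CD _ _ (Cv' v) C'v; rewrite subrK.
apply/eqP; rewrite eq_le -[_ <= 1]subr_ge0 -[1 <= _]subr_ge0.
apply/andP; split; rewrite leNgt; apply/negP => lt0; apply: Nb';
  apply: convex_cone_opp_lt0 lt0 _ => //; rewrite scalerBl scale1r.
  exact: Cv.
exact: Cv'.
Qed.

(* With [A] of maximal rank among matrices whose rows lie in [C], the sum [b] of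
   its rows is an order unit of [C] in its span. *)
Lemma cone_dichotomy m (C : set 'rV[R]_m) : convex_cone C ->
  (forall v, C v -> C (- v)) \/
  exists l : 'rV[R]_m, (forall v, C v -> 0 <= dotp l v) /\
    exists2 b, C b & 0 < dotp l b.
Proof.
move=> coneC; have [C0 CD CZ] := coneC.
pose Q r := `[< exists2 A : 'M[R]_(r, m), forall i, C (row i A) & row_free A >].
have exQ : exists r, Q r.
  exists 0%N; apply/asboolP; exists 0; last by rewrite /row_free mxrank0.
  by case.
have boundQ r : Q r -> (r <= m)%N.
  by move=> /asboolP[A _ /eqP <-]; exact: rank_leq_col.
have [r /asboolP[A CA freeA] maxA] := ex_maxnP exQ boundQ.
(* A vector of [C] outside the row space could be appended to [A], against maximality. *)
have CsubA v : C v -> (v <= A)%MS.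
  move=> Cv; apply: contraT => vA.
  suff /asboolP/maxA : exists2 B : 'M[R]_(r + 1, m),
      forall i, C (row i B) & row_free B by rewrite addn1 ltnn.
  exists (col_mx A v) => [i|].
    rewrite -[i]splitK; case: (fintype.split i) => j /=;
      by rewrite ?rowKu ?rowKd// ord1 row_id.
  rewrite -row_leq_rank -addsmxE addn1 -{1}(eqP freeA) rank_ltmx//.
  by rewrite ltmxE addsmxSl addsmx_sub submx_refl.
(* [p] fixes the row space of [A], so [b] is an order unit in the whole space for the preimage of
   [C] under [p]. *)
pose p := pinvmx A *m A.
have pid v : (v <= A)%MS -> v *m p = v by move=> vA; rewrite /p mulmxA mulmxKpV.
pose b := \sum_i row i A.
have Cb : C b by exact: big_ind.
have bA : (b <= A)%MS by exact: CsubA.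
have unitb v : (v <= A)%MS -> exists t, C (t *: b - v).
  move=> /submxP[u ->]; exists (\sum_i `|u 0 i|).
  rewrite mulmx_sum_row /b scaler_sumr -sumrB; apply: (big_ind C) => // i _.
  rewrite -scalerBl; apply: CZ => //; rewrite subr_ge0 (le_trans (ler_norm _))//.
  by rewrite (bigD1 i)//= lerDl sumr_ge0.
have [CNb|CNb] := pselect (C (- b)).
  left => v Cv; have [t Ct] := unitb _ (CsubA _ Cv).
  (* Since [t] may be negative, [|t|] is used to write [- v] with nonnegative coefficients only. *)
  have -> : - v = (t *: b - v) + (`|t| - t) *: b + `|t| *: (- b).
    by apply/rowP => i; rewrite !mxE; ring.
  apply: (CD); [apply: CD => //|]; apply: CZ => //.
  by rewrite subr_ge0 ler_norm.
right; have [|v||] := @order_unit_functional _ [set v | C (v *m p)] b.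
- split=> /= [|u v ? ?|k v k0 ?]; first by rewrite mul0mx.
    by rewrite mulmxDl; exact: CD.
  by rewrite -scalemxAl; exact: CZ.
- have [|t Ct] := unitb (v *m p); first by rewrite /p mulmxA submxMl.
  by exists t; rewrite /= mulmxBl -scalemxAl pid.
- by rewrite /= mulNmx pid.
move=> l [Cl lb]; exists l; split; last by exists b => //; rewrite lb.
by move=> v Cv; apply: Cl; rewrite /= pid//; exact: CsubA.
Qed.
End convex_cones.

(** * The minimal face described by prolongation of segments *)

Section minimal_face.
Context (R : realType) (n : nat) (K : set 'rV[R]_n).
Hypothesis convK : convex_set (K : set (convex_lmodType 'rV[R]_n)).

Lemma convex_setP (y z : 'rV[R]_n) (t : R) :
  K y -> K z -> 0 <= t <= 1 -> K (t *: y + (1 - t) *: z).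
Proof.
move=> Ky Kz /andP[t0 t1]; apply/set_mem.
by apply: (convK (Itv01 t0 t1)); apply/mem_set.
Qed.

(** The points [y] whose segment to [x] can be prolonged beyond [x] inside [K] form a face
    containing [x]; conversely [x] lies strictly between such a [y] and the prolonged point, so
    every face containing [x] contains [y]. *)
Lemma minimal_faceP (x y : 'rV[R]_n) : K x ->
  minimal_face K x y <-> K y /\ exists2 t, 0 < t & K (x + t *: (x - y)).
Proof.
move=> Kx; split=> [|[Ky [t t0 Kt]] F [[FK faceF] Fx]]; last first.
  have t1 : 1 + t != 0 by rewrite gt_eqF// addr_gt0.
  have [] // := faceF x y (x + t *: (x - y)) (t / (1 + t)) Fx Ky Kt.
    by rewrite divr_gt0 ?addr_gt0//= ltr_pdivrMr ?addr_gt0// mul1r ltrDr.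
  by apply/rowP => i; rewrite !mxE; field.
pose F := [set z | K z /\ exists2 t, 0 < t & K (x + t *: (x - z))].
move=> /(_ F); apply; split; last first.
  by split=> //; exists 1 => //; rewrite subrr scaler0 addr0.
split=> [z []//|].
suff prolong z a b r : K a -> K b -> 0 < r < 1 ->
    (exists2 t, 0 < t & K (x + t *: (x - z))) ->
    z = r *: a + (1 - r) *: b -> exists2 t, 0 < t & K (x + t *: (x - a)).
  move=> z a b r [Kz exz] Ka Kb r01 zE; split; split=> //.
    exact: prolong zE.
  apply: (prolong z b a (1 - r)) => //; first lra.
  by rewrite zE addrC subKr.
move=> Ka Kb /andP[r0 r1] [s s0 Ks] zE; rewrite {}zE in Ks.
have s1 : 0 < 1 + s by rewrite addr_gt0.
have d0 : 0 < 1 + s - s * r by nra.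
(* Averaging the prolonged point with [b], with weight [(1 + s - s * r)^-1] on the former, cancels
   [b] and leaves a point on the line through [a] and [x]. *)
exists (s * r / (1 + s - s * r)); first by rewrite divr_gt0 ?mulr_gt0.
have := @convex_setP _ b (1 + s - s * r)^-1 Ks Kb.
rewrite invr_ge0 ltW//= invf_le1//; have -> : 1 <= 1 + s - s * r by nra.
move=> /(_ isT); congr K; apply/rowP => i; rewrite !mxE; field.
by rewrite gt_eqF.
Qed.

End minimal_face.

(** * Reduction of convex combinations to [n + 1] points *)

Section caratheodory.
Context (R : realType) (n : nat) (K : set 'rV[R]_n) (h : 'rV[R]_n -> R)
  (x : 'rV[R]_n).
Hypothesis Kx : K x.
Hypothesis h_ge0 : forall (xs : 'I_n.+1 -> 'rV[R]_n) (lam : 'I_n.+1 -> R),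
  (forall i, K (xs i)) -> (forall i, 0 <= lam i) -> \sum_i lam i = 1 ->
  x = \sum_i lam i *: xs i -> 0 <= \sum_i lam i * h (xs i).

(* Moving the weights along an affine dependency in the direction that does not
   increase the average of [h] makes one of them vanish. *)
Lemma caratheodory_ord m (xs : 'I_(m + n.+1) -> 'rV[R]_n)
    (lam : 'I_(m + n.+1) -> R) :
  (forall i, K (xs i)) -> (forall i, 0 <= lam i) -> \sum_i lam i = 1 ->
  x = \sum_i lam i *: xs i -> 0 <= \sum_i lam i * h (xs i).
Proof.
elim: m xs lam => [|m IHm] /= xs lam Kxs lam0 lam1 xE; first exact: h_ge0.
have [mu [mu_neq0 mu_xs mu_sum mu_h]] : exists mu : 'rV[R]_(m + n.+1).+1,
  [/\ mu != 0, \sum_i mu 0 i *: xs i = 0, \sum_i mu 0 i = 0 &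
      \sum_i mu 0 i * h (xs i) <= 0].
  (* A left kernel vector of [P] is an affine dependency; one exists because [P] has [m + n + 2]
     rows and only [n + 1] columns. *)
  pose P := row_mx (\matrix_i xs i) (const_mx 1 : 'cV[R]_(m + n.+1).+1).
  have : kermx P != 0.
    rewrite kermx_eq0 -row_leq_rank -ltnNge ltnS.
    by rewrite (leq_trans (rank_leq_col _))// addn1 leq_addl.
  move=> /rowV0Pn[v /sub_kermxP]; rewrite mul_mx_row => /eqP.
  rewrite -row_mx0 => /eqP/eq_row_mx[v1 v2] v_neq0.
  have v_xs : \sum_i v 0 i *: xs i = 0.
    rewrite -[RHS]v1 mulmx_sum_row; apply: eq_bigr => i _.
    by rewrite rowK.
  have v_sum : \sum_i v 0 i = 0.
    have /matrixP/(_ 0 0) := v2; rewrite !mxE => v2'.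
    by rewrite -[RHS]v2'; apply: eq_bigr => i _; rewrite mxE mulr1.
  have [vh|vh] := lerP (\sum_i v 0 i * h (xs i)) 0; first by exists v.
  exists (- v); rewrite oppr_eq0; split=> //.
  - by under eq_bigr do rewrite mxE scaleNr; rewrite sumrN v_xs oppr0.
  - by under eq_bigr do rewrite mxE; rewrite sumrN v_sum oppr0.
  - by under eq_bigr do rewrite mxE mulNr; rewrite sumrN oppr_le0 ltW.
have [i1 mu_lt0] : exists i, mu 0 i < 0.
  apply: contrapT => /forallNP mu_ge0; case/eqP: mu_neq0.
  apply/rowP => i; rewrite mxE; apply/eqP; move/eqP: mu_sum.
  rewrite psumr_eq0 => [/allP/(_ i)|j _]; first by rewrite mem_index_enum; apply.
  by rewrite leNgt; apply/negP/mu_ge0.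
(* The least ratio is the largest step along [mu] that keeps all weights nonnegative. *)
case: (@arg_minP _ _ _ i1 (fun i => mu 0 i < 0) (fun i => lam i / - mu 0 i))
  => // i0 mu0 min0.
pose t := lam i0 / - mu 0 i0.
have t_ge0 : 0 <= t by rewrite divr_ge0// oppr_ge0 ltW.
pose lam' i := lam i + t * mu 0 i.
have lam'0 : lam' i0 = 0.
  by rewrite /lam' /t; field; rewrite lt_eqF.
have lam'_ge0 i : 0 <= lam' i.
  have [mui|mui] := lerP 0 (mu 0 i); first by rewrite addr_ge0// mulr_ge0.
  have := min0 _ mui; rewrite -/t ler_pdivlMr ?oppr_gt0// /lam'; lra.
have drop (V : lmodType R) (F : 'I_(m + n.+1).+1 -> V) : F i0 = 0 ->
    \sum_i F i = \sum_i F (lift i0 i).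
  by move=> F0; rewrite (bigD1_ord i0)//= F0 add0r.
suff : 0 <= \sum_i lam' i * h (xs i).
  have -> : \sum_i lam' i * h (xs i) =
      \sum_i lam i * h (xs i) + t * \sum_i mu 0 i * h (xs i).
    by rewrite mulr_sumr -big_split; apply: eq_bigr => i _; rewrite mulrDl mulrA.
  nra.
rewrite (drop R^o); last by rewrite lam'0 mul0r.
apply: (IHm (xs \o lift i0) (lam' \o lift i0)) => //=.
- by rewrite -(drop R^o lam')// big_split/= lam1 -mulr_sumr mu_sum mulr0 addr0.
- rewrite -(drop _ (fun i => lam' i *: xs i)); last by rewrite lam'0 scale0r.
  have -> : x = x + t *: \sum_i mu 0 i *: xs i by rewrite mu_xs scaler0 addr0.
  rewrite [in LHS]xE scaler_sumr -big_split.
  by apply: eq_bigr => i _; rewrite scalerDl scalerA.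
Qed.

(** Padding with [n.+1] copies of [x] of weight zero gives any finite family the index shape
    [m + n.+1]. *)
Lemma caratheodory (I : finType) (xs : I -> 'rV[R]_n) (lam : I -> R) :
  (forall i, K (xs i)) -> (forall i, 0 <= lam i) -> \sum_i lam i = 1 ->
  x = \sum_i lam i *: xs i -> 0 <= \sum_i lam i * h (xs i).
Proof.
pose ext U (F : I -> U) u (i : 'I_(#|I| + n.+1)) :=
  if fintype.split i is inl j then F (enum_val j) else u.
have extE (V : nmodType) (F : 'I_(#|I| + n.+1) -> V) (G : I -> V) :
    (forall j : 'I_#|I|, F (lshift _ j) = G (enum_val j)) ->
    (forall j, F (rshift _ j) = 0) -> \sum_i F i = \sum_i G i.
  move=> FG F0; rewrite big_split_ord /= (eq_bigr _ (fun j _ => FG j)).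
  rewrite [X in _ + X]big1 // addr0.
  exact: (esym (@big_enum_val _ _ _ I predT G)).
move=> Kxs lam0 lam1 xE.
have extl U (F : I -> U) u j : ext U F u (lshift _ j) = F (enum_val j).
  by rewrite /ext (unsplitK (inl j)).
have extr U (F : I -> U) u j : ext U F u (rshift _ j) = u.
  by rewrite /ext (unsplitK (inr j)).
have := @caratheodory_ord _ (ext _ xs x) (ext _ lam 0).
rewrite (extE _ _ lam) => [||j]; [|by move=> j; rewrite extl|by rewrite extr].
rewrite (extE _ _ (fun i => lam i *: xs i)) => [||j];
  [|by move=> j; rewrite !extl|by rewrite !extr scale0r].
rewrite (extE _ _ (fun i => lam i * h (xs i))) => [||j];
  [|by move=> j; rewrite !extl|by rewrite !extr mul0r].
by apply => // i; rewrite /ext; case: fintype.split.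
Qed.
End caratheodory.

(** * From condition (i) to the slope [gamma] *)

Section supporting_functional.
Context (R : realType) (n : nat) (K : set 'rV[R]_n).
Hypothesis convK : convex_set (K : set (convex_lmodType 'rV[R]_n)).

(** Prolonging back from the new point by [t^-1] returns to [y], so the new point belongs to the
    face as well. *)
Lemma minimal_face_prolong (x y : 'rV[R]_n) : K x -> minimal_face K x y ->
  exists2 t, 0 < t & minimal_face K x (x + t *: (x - y)).
Proof.
move=> Kx /(minimal_faceP convK _ Kx)[Ky [t t0 Kt]]; exists t => //.
apply/(minimal_faceP convK) => //; split=> //; exists t^-1; first by rewrite invr_gt0.
by have -> : x + t^-1 *: (x - (x + t *: (x - y))) = y
  by apply/rowP => i; rewrite !mxE; field; rewrite gt_eqF.
Qed.

Lemma minimal_face_id (x : 'rV[R]_n) : K x -> minimal_face K x x.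
Proof. by move=> Kx F []. Qed.

(* Separates from [(0, -1)] the convex cone generated by the points
   [(y - x, s)] with [y] in the minimal face and [s >= h y]. *)
Lemma supporting_functional (h : 'rV[R]_n -> R) (x : 'rV[R]_n) : K x ->
  (forall (xs : 'I_n.+1 -> 'rV[R]_n) (lam : 'I_n.+1 -> R),
    (forall i, K (xs i)) -> (forall i, 0 <= lam i) -> \sum_i lam i = 1 ->
    x = \sum_i lam i *: xs i -> 0 <= \sum_i lam i * h (xs i)) ->
  exists gamma : 'rV[R]_n, forall y, minimal_face K x y ->
    0 <= h y + dotp gamma (y - x).
Proof.
move=> Kx h_ge0.
pose C := [set v : 'rV[R]_(n + 1) | exists (I : finType) (a : I -> R)
  (y : I -> 'rV[R]_n), [/\ forall i, 0 <= a i, forall i, minimal_face K x (y i),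
    lsubmx v = \sum_i a i *: (y i - x) &
    \sum_i a i * h (y i) <= rsubmx v 0 0]].
have FK y : minimal_face K x y -> K y by move=> /(minimal_faceP convK _ Kx)[].
have coneC : convex_cone C.
  split.
  - exists 'I_0, (fun=> 0), (fun=> 0).
    by split=> [[]|[]||] //; rewrite !big_ord0 ?linear0 ?mxE.
  - move=> u v [I [a [y [a0 Fy yE hE]]]] [J [b [z [b0 Fz zE gE]]]].
    exists (I + J)%type, (fun i => match i with inl i => a i | inr j => b j end),
      (fun i => match i with inl i => y i | inr j => z j end).
    split=> [[]|[]||] //; rewrite big_sumType/=.
      by rewrite linearD/= yE zE.
    by rewrite linearD/= mxE lerD.
  - move=> k v k0 [I [a [y [a0 Fy yE hE]]]].
    exists I, (fun i => k * a i), y; split=> [i|//||].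
    + exact: mulr_ge0.
    + rewrite linearZ/= yE scaler_sumr.
      by apply: eq_bigr => i _; rewrite scalerA.
    + rewrite linearZ/= mxE; under eq_bigr do rewrite -mulrA.
      by rewrite -mulr_sumr ler_wpM2l.
pose e : 'rV[R]_(n + 1) := row_mx 0 1.
have Ce : C e.
  exists 'I_0, (fun=> 0), (fun=> 0).
  by split=> [[]|[]||] //; rewrite !big_ord0 ?row_mxKl ?row_mxKr ?mxE.
have CF y : minimal_face K x y -> C (row_mx (y - x) (h y)%:M).
  move=> Fy; exists 'I_1, (fun=> 1), (fun=> y).
  by split=> //; rewrite big_ord1 ?scale1r ?mul1r ?row_mxKl ?row_mxKr ?mxE.
have dotpE l (v : 'rV[R]_(n + 1)) :
    dotp l v = dotp (lsubmx l) (lsubmx v) + rsubmx l 0 0 * rsubmx v 0 0.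
  rewrite /dotp big_split_ord big_ord1/= !mxE !ord1.
  by congr (_ + _); apply: eq_bigr => i _; rewrite !mxE.
have [CN|[l [lC [b [I [a [y [a0 Fy bE hE]]]] lb]]]] := cone_dichotomy coneC.
  have [I [a [y [a0 Fy]]]] := CN _ Ce.
  rewrite !linearN /= row_mxKl row_mxKr oppr0 !mxE /= => yE hE.
  (* If [C] were a subspace it would contain [(0, -1)]. Dividing by the total weight [S] then gives
     a convex combination equal to [x] on which [h] has negative average. *)
  pose S := \sum_i a i.
  have S0 : S != 0.
    apply/eqP => /eqP; rewrite psumr_eq0// => /allP aS.
    move: hE; rewrite big1 => [|i _]; first lra.
    by have /eqP -> := aS i (mem_index_enum _); rewrite mul0r.
  have Sgt0 : 0 < S by rewrite lt_neqAle eq_sym S0 sumr_ge0.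
  have : 0 <= \sum_i (S^-1 * a i) * h (y i).
    apply: (caratheodory Kx h_ge0) => [i|i||].
    + exact: FK.
    + by rewrite mulr_ge0// invr_ge0 ltW.
    + by rewrite -mulr_sumr mulVf.
    + under eq_bigr do rewrite -scalerA; rewrite -scaler_sumr.
      apply: (scalerI S0); rewrite scalerA mulfV// scale1r.
      move: yE; under eq_bigr do rewrite scalerBr; rewrite sumrB -scaler_suml.
      by move=> /esym/eqP; rewrite subr_eq0 => /eqP ->.
  under eq_bigr do rewrite -mulrA.
  by rewrite -mulr_sumr pmulr_rge0 ?invr_gt0//; lra.
pose g := lsubmx l; pose al := rsubmx l 0 0.
have al0 : 0 <= al.
  have := lC _ Ce; rewrite dotpE row_mxKl row_mxKr [X in _ * X]mxE eqxx mulr1.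
  by rewrite dotp0r add0r.
have gF z : minimal_face K x z -> 0 <= dotp g (z - x) + al * h z.
  by move=> /CF/lC; rewrite dotpE row_mxKl row_mxKr [X in _ * X]mxE.
have [alE|al_neq0] := eqVneq al 0; last first.
  have al_gt0 : 0 < al by rewrite lt_neqAle eq_sym al_neq0.
  exists (al^-1 *: g) => z /gF gz.
  rewrite dotpZl -(pmulr_rge0 _ al_gt0) mulrDr mulrA mulfV// mul1r; lra.
(* The vertical case: [g] is nonnegative on the face directions, and prolongation beyond [x]
   reverses their sign, so [g] vanishes there, against [lb]. *)
have g0 z : minimal_face K x z -> dotp g (z - x) = 0.
  move=> Fz; have [t t0 /gF] := minimal_face_prolong Kx Fz.
  have := gF _ Fz; rewrite alE !mul0r !addr0 (addrC x) addrK dotpZr pmulr_rge0//.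
  by rewrite -opprB dotpNr => ? ?; lra.
move: lb; rewrite dotpE -/g -/al alE mul0r addr0 bE dotp_sumr big1 ?ltxx// => i _.
by rewrite dotpZr g0 ?mulr0.
Qed.

End supporting_functional.

(** * Expectations of functions of a bounded random vector *)

Lemma normr_coord_le (R : realType) m n (v : 'M[R]_(m, n)) i j :
  `|v i j| <= `|v|.
Proof.
rewrite [leRHS]/Num.norm /= mx_normrE.
exact: (le_bigmax _ (fun ij => `|v ij.1 ij.2|) (i, j)).
Qed.

Section random_vector.
Context d (T : measurableType d) (R : realType) (n : nat) (P : probability T R).
Variable X : {RV P >-> borel_rV R n}.

(** [K] may fail to be Borel. A relatively open subset of [K] is the trace of an open [V], and since
    [X] takes values in [K] its preimage is that of [V]. *)
Lemma measurable_within_comp (K : set 'rV[R]_n) (h : 'rV[R]_n -> R) :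
  {within K, continuous h} -> (forall w, K (X w)) ->
  measurable_fun setT (fun w => h (X w)).
Proof.
move=> /continuousP ch KX.
apply: (measurability _ (RGenOpens.measurableE R)).
move=> _ [_ [a [b ->] <-]].
have /open_subspaceP[V oV VK] := ch _ (@interval_open _ (BRight a) (BLeft b) isT isT).
rewrite setTI (_ : _ @^-1` _ = X @^-1` V).
  rewrite -[X in measurable X]setTI.
  by apply: (measurable_funPT X) => //; exact: sub_sigma_algebra.
apply/seteqP; split=> w /= hw.
  by have [] : (V `&` K) (X w) by rewrite VK; split => //; exact: KX.
by have [] : (from_subspace K h @^-1` [set` `]a, b[] `&` K) (X w)
  by rewrite -VK; split => //; exact: KX.
Qed.

Hypothesis bndX : bounded_set (range (X : T -> 'rV[R]_n)).

Lemma integrable_coord i : P.-integrable setT (fun w => (X w ord0 i)%:E).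
Proof.
apply: (measurable_bounded_integrable (f := fun w => X w ord0 i)) => //.
- by rewrite (le_lt_trans (probability_le1 _ _))// ltry.
- apply: (@measurable_within_comp setT (fun v => v ord0 i)) => //.
  exact/continuous_subspaceT/coord_continuous.
- have [M [Mreal HM]] := bndX; exists M; split => // N MN w _.
  by apply: (le_trans (normr_coord_le _ _ _)); apply: HM => //; exists w.
Qed.

Lemma EFin_dotp_sub (l x : 'rV[R]_n) :
  (fun w => (dotp l (X w - x))%:E) =
  (fun w => \sum_i ((l ord0 i)%:E * ((X w ord0 i)%:E - (x ord0 i)%:E)))%E.
Proof.
apply/funext => w; rewrite /dotp -sumEFin; apply: eq_bigr => i _.
by rewrite !mxE EFinM EFinB.
Qed.

Lemma integrable_dotp (l x : 'rV[R]_n) :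
  P.-integrable setT (fun w => (dotp l (X w - x))%:E).
Proof.
rewrite EFin_dotp_sub.
apply: integrable_sum => // i _; apply: integrableZl => //.
apply: integrableB => //; first exact: integrable_coord.
exact: finite_measure_integrable_cst.
Qed.

Lemma integral_dotp (l x : 'rV[R]_n) : has_barycentre P X x ->
  (\int[P]_w (dotp l (X w - x))%:E = 0)%E.
Proof.
move=> Xx.
have int_cst i : P.-integrable setT (EFin \o cst (x ord0 i)).
  exact: finite_measure_integrable_cst.
have intB i : P.-integrable setT (fun w => ((X w ord0 i)%:E - (x ord0 i)%:E)%E).
  by apply: integrableB => //; [exact: integrable_coord|exact: int_cst].
rewrite EFin_dotp_sub integral_sum// => [|i]; last exact: integrableZl.
rewrite big1// => i _; rewrite integralZl//.
rewrite integralB_EFin//; [|exact: integrable_coord|exact: int_cst].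
have := Xx i; rewrite unlock => ->.
by rewrite integral_cst//= probability_setT mule1 subee// mule0.
Qed.

End random_vector.

(* [Y] and [Z] need not be integrable, so [Y <= Z + G] is integrated in the
   subtraction-free form [Y^+ + Z^- + G^- <= Z^+ + G^+ + Y^-]. *)
Lemma le_expectation_perturbed d (T : measurableType d) (R : realType)
    (P : probability T R) (Y Z G : T -> R) :
  measurable_fun setT Y -> measurable_fun setT Z ->
  P.-integrable setT (EFin \o G) -> (\int[P]_w (G w)%:E = 0)%E ->
  has_expectation P Y -> has_expectation P Z ->
  {ae P, forall w, Y w <= Z w + G w} -> ('E_P[Y] <= 'E_P[Z])%E.
Proof.
move=> mY mZ intG G0 exY exZ YZ.
have mG : measurable_fun setT G by apply/measurable_EFinP; case/integrableP: intG.
move: exY exZ; rewrite /has_expectation unlock.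
rewrite ![X in (X <= _)%E]integralE ![X in (_ <= X)%E]integralE.
have E (f : T -> R) : (fun w => (f w)%:E) = EFin \o f by [].
rewrite !E !funerpos !funerneg.
have ge0 (f : T -> R) : (forall w, 0 <= f w) -> (0 <= \int[P]_w (f w)%:E)%E.
  by move=> f0; apply: integral_ge0 => w _; rewrite lee_fin.
have mp (f : T -> R) : measurable_fun setT f -> measurable_fun setT (EFin \o f^\+).
  by move=> mf; apply/measurable_EFinP; exact: measurable_funrpos.
have mn (f : T -> R) : measurable_fun setT f -> measurable_fun setT (EFin \o f^\-).
  by move=> mf; apply/measurable_EFinP; exact: measurable_funrneg.
have split_le : (\int[P]_w (Y^\+ w)%:E + \int[P]_w (Z^\- w)%:E +
      \int[P]_w (G^\- w)%:E <=
    \int[P]_w (Z^\+ w)%:E + \int[P]_w (G^\+ w)%:E + \int[P]_w (Y^\- w)%:E)%E.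
  have mD (f g : T -> \bar R) : measurable_fun setT f -> measurable_fun setT g ->
    measurable_fun setT (fun w => f w + g w)%E by exact: emeasurable_funD.
  rewrite -!ge0_integralD//; try (by move=> *; rewrite ?adde_ge0// ?lee_fin);
    try by repeat apply: (mD); first [exact: mp|exact: mn].
  apply: ae_ge0_le_integral => //; try (by move=> *; rewrite ?adde_ge0// ?lee_fin);
    try by repeat apply: (mD); first [exact: mp|exact: mn].
  apply: filterS YZ => w YZ _; rewrite -!EFinD lee_fin.
  have posneg (f : T -> R) : f^\+ w = f w + f^\- w.
    rewrite /funrpos /funrneg; case: (leP (f w) 0) => f0.
      by rewrite max_l ?subrr// oppr_ge0.
    by rewrite max_r ?addr0// oppr_le0 ltW.
  rewrite !posneg; lra.
(* Both parts of [G] have the same finite integral, which therefore cancels. *)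
have [gp_fin gn_fin] : (\int[P]_w (G^\+ w)%:E)%E \is a fin_num /\
    (\int[P]_w (G^\- w)%:E)%E \is a fin_num.
  by split; apply: integrable_fin_num => //;
    [exact: integrable_funrpos|exact: integrable_funrneg].
have gE : (\int[P]_w (G^\+ w)%:E = \int[P]_w (G^\- w)%:E)%E.
  move: G0; rewrite [X in X = _]integralE E funerpos funerneg.
  rewrite -(fineK gp_fin) -(fineK gn_fin) -EFinB => -[/eqP].
  by rewrite subr_eq0 => /eqP ->.
move: split_le; rewrite gE [leRHS]addeAC leeD2rE// => split_le.
have := split_le.
move: (ge0 _ (funrpos_ge0 Y)) (ge0 _ (funrneg_ge0 Y))
  (ge0 _ (funrpos_ge0 Z)) (ge0 _ (funrneg_ge0 Z)).
move: (\int[P]_w (Y^\+ w)%:E)%E (\int[P]_w (Y^\- w)%:E)%E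
  (\int[P]_w (Z^\+ w)%:E)%E (\int[P]_w (Z^\- w)%:E)%E.
move=> [yp| |] [yn| |] [zp| |] [zn| |] //; rewrite ?leey ?leNye//.
- by rewrite -!EFinD !lee_fin => _ _ _ _ + _ _; lra.
(* Here and in the next case both parts of [Z] have infinite integral, which [has_expectation P Z]
   excludes. *)
- by rewrite ltxx => _ _ _ _ _ _ [].
- by rewrite ltxx => _ _ _ _ _ _ [].
Qed.

(** * Almost sure membership in the minimal face *)

Section ae_minimal_face.
Context d (T : measurableType d) (R : realType) (n : nat) (P : probability T R).
Variables (K : set 'rV[R]_n) (X : {RV P >-> borel_rV R n}) (x : 'rV[R]_n).
Hypothesis convK : convex_set (K : set (convex_lmodType 'rV[R]_n)).
Hypothesis Kx : K x.
Hypothesis bndX : bounded_set (range (X : T -> 'rV[R]_n)).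
Hypothesis KX : forall w, K (X w).
Hypothesis Xx : has_barycentre P X x.

(** The barycentre condition gives this variable mean zero, and a nonnegative variable of mean zero
    vanishes almost surely. *)
Lemma ae_dotp_eq0 (l : 'rV[R]_n) :
  {ae P, forall w, 0 <= dotp l (X w - x)} ->
  {ae P, forall w, dotp l (X w - x) = 0}.
Proof.
move=> l_ge0.
have mf : measurable_fun setT (fun w => (dotp l (X w - x))%:E).
  by have /integrableP[] := integrable_dotp bndX l x.
have : (\int[P]_w `|(dotp l (X w - x))%:E| = 0)%E.
  rewrite -(integral_dotp bndX l Xx); apply: ae_eq_integral => //.
    exact: measurableT_comp.
  by apply: filterS l_ge0 => w lw _; rewrite gee0_abs ?lee_fin.
move=> /(ae_eq_integral_abs P measurableT mf).
by apply: filterS => w /(_ I)[].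
Qed.

(* If the cone of directions in which [K], cut by a subspace [A] supporting
   [X - x], leaves [x] is not a subspace, then a functional nonnegative on it
   vanishes almost surely at [X - x], which cuts [A] down. *)
Lemma ae_minimal_face_subspace (A : 'M[R]_n) :
  {ae P, forall w, (X w - x <= A)%MS} ->
  {ae P, forall w, minimal_face K x (X w)}.
Proof.
have [r] := ubnP (\rank A); elim: r A => // r IHr A rankA XA.
pose C := [set v : 'rV[R]_n | exists s y,
  [/\ 0 <= s, K y, (y - x <= A)%MS & v = s *: (y - x)]].
have coneC : convex_cone C.
  split.
  - by exists 0, x; rewrite subrr sub0mx scale0r.
  - move=> _ _ [s [y [s0 Ky yA ->]]] [t [z [t0 Kz zA ->]]].
    have [st0|st_neq0] := eqVneq (s + t) 0.
      move/eqP: st0; rewrite paddr_eq0// => /andP[/eqP -> /eqP ->].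
      by exists 0, x; rewrite subrr sub0mx !scale0r addr0.
    have st_gt0 : 0 < s + t by rewrite lt_neqAle eq_sym st_neq0 addr_ge0.
    have E : s *: (y - x) + t *: (z - x) = (s + t) *:
        ((s / (s + t)) *: y + (1 - s / (s + t)) *: z - x).
      by apply/rowP => i; rewrite !mxE; field.
    exists (s + t), ((s / (s + t)) *: y + (1 - s / (s + t)) *: z); split => //.
    + exact: ltW.
    + apply: convex_setP => //; rewrite divr_ge0 ?addr_ge0//=.
      by rewrite ler_pdivrMr// mul1r lerDl.
    + by rewrite -(eqmx_scale _ st_neq0) -E addmx_sub ?scalemx_sub.
  - move=> k _ k0 [s [y [s0 Ky yA ->]]].
    by exists (k * s), y; rewrite scalerA mulr_ge0.
have CX w : (X w - x <= A)%MS -> C (X w - x).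
  by move=> XwA; exists 1, (X w); rewrite scale1r; split.
have [CN|[l [lC [b Cb lb]]]] := cone_dichotomy coneC.
  (* As [C] is symmetric, [x - X w] equals [s *: (y - x)] with [y] in [K]; for nonzero [s], [y]
     prolongs the segment from [X w] beyond [x]. *)
  apply: filterS XA => w /CX/CN[s [y [s0 Ky _ E]]].
  have [sE|s_neq0] := eqVneq s 0.
    move: E; rewrite sE scale0r => /eqP; rewrite oppr_eq0 subr_eq0 => /eqP ->.
    exact: minimal_face_id.
  apply/(minimal_faceP convK) => //; split; first exact: KX.
  exists s^-1; first by rewrite invr_gt0 lt_neqAle eq_sym s_neq0.
  by rewrite -(opprB (X w)) E scalerA mulVf// scale1r addrC subrK.
apply: (IHr (A :&: kermx l^T)%MS).
  (* The rank drops because [b] lies in the row space of [A] but not in the kernel of [l]. *)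
  rewrite -ltnS; apply: leq_trans rankA; rewrite ltnS; apply: rank_ltmx.
  rewrite ltmxE capmxSl; apply/negP => AK.
  have [s [y [_ _ yA bE]]] := Cb.
  have /sub_kermxP : (b <= kermx l^T)%MS.
    rewrite bE; apply: scalemx_sub; apply: submx_trans yA _.
    exact: submx_trans AK (capmxSr _ _).
  by move=> /matrixP/(_ 0 0); rewrite dotp_mulmx mxE => lb0; rewrite lb0 ltxx in lb.
have : {ae P, forall w, dotp l (X w - x) = 0}.
  apply: ae_dotp_eq0; apply: filterS XA => w /CX; exact: lC.
apply: filterS2 XA => w XwA lw; rewrite sub_capmx XwA; apply/sub_kermxP.
by apply/matrixP => i j; rewrite !ord1 dotp_mulmx lw mxE.
Qed.

Lemma ae_minimal_face : {ae P, forall w, minimal_face K x (X w)}.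
Proof.
apply: (@ae_minimal_face_subspace 1%:M); apply: aeW => w.
exact: submx1.
Qed.

End ae_minimal_face.

Lemma within_continuous_precomp (U V W : topologicalType) (A : set U) (B : set V)
    (g : U -> V) (F : V -> W) :
  continuous g -> (forall u, A u -> B (g u)) ->
  {within B, continuous F} -> {within A, continuous (F \o g)}.
Proof.
move=> cg AB /subspace_continuousP cF; apply/subspace_continuousP => u Au.
move=> N /(cF _ (AB _ Au)) NF.
by apply: (@filterS _ (nbhs u)) (cg u _ NF) => v BN Av; apply/BN/AB.
Qed.

(** * Laws with finitely many atoms *)

Section finite_law.
Context (R : realType) (n : nat) (lam : 'I_n.+1 -> R).
Hypothesis lam_ge0 : forall i, 0 <= lam i.
Hypothesis lam_sum1 : \sum_i lam i = 1.

(** The atoms are [0, ..., n] with weights [lam]. The carrier [nat] has every subset measurable, so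
    any sequence is a random variable. *)
Definition finite_law_measure : set nat -> \bar R :=
  msum (fun k => mscale (NngNum (lam_ge0 (inord k))) \d_k) n.+1.

HB.instance Definition _ := Measure.on finite_law_measure.

Lemma finite_law_setT : finite_law_measure [set: nat] = 1%E.
Proof.
rewrite /finite_law_measure /msum /= /mscale /=.
rewrite -[RHS]/(1%:E) -lam_sum1 -sumEFin; apply: eq_bigr => i _.
by rewrite -[LHS]/(_ * \d_(i : nat) setT)%E diracT mule1 inord_val.
Qed.

HB.instance Definition _ :=
  Measure_isProbability.Build _ _ _ finite_law_measure finite_law_setT.

Definition finite_law : probability nat R := finite_law_measure.

Lemma expectation_finite_law (Y : nat -> R) :
  ('E_finite_law[Y])%E = (\sum_i lam i * Y i)%:E.
Proof.
have ge0E (g : nat -> R) : (forall k, 0 <= g k) ->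
    (\int[finite_law]_k (g k)%:E = (\sum_i lam i * g i)%:E)%E.
  move=> g0; rewrite [LHS]ge0_integral_measure_sum//; last first.
    by move=> k _; rewrite lee_fin.
  rewrite -sumEFin; apply: eq_bigr => i _.
  rewrite ge0_integral_mscale//; last by move=> k _; rewrite lee_fin.
  by rewrite integral_dirac//= diracT mul1e inord_val EFinM.
rewrite unlock integralE.
rewrite -[fun w => (Y w)%:E]/(EFin \o Y) funerpos funerneg /=.
rewrite (ge0E _ (funrpos_ge0 Y)) (ge0E _ (funrneg_ge0 Y)) -EFinB -sumrB.
congr EFin; apply: eq_bigr => i _; rewrite -mulrBr; congr (_ * _).
rewrite /funrpos /funrneg; case: (leP (Y i) 0) => Y0.
  by rewrite max_l ?oppr_ge0// sub0r opprK.
by rewrite max_r ?subr0// oppr_le0 ltW.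
Qed.

Lemma has_expectation_finite_law (Y : nat -> R) : has_expectation finite_law Y.
Proof. by left; rewrite expectation_finite_law ltry. Qed.

End finite_law.

(** * The cycle of implications (i), (ii), (iii), (i) *)

Theorem theorem4p3 (R : realType) (n : nat) (K : set 'rV[R]_n)
    (c : 'rV[R]_n -> 'rV[R]_n -> R) (f : two_copies 'rV[R]_n -> R)
    (x : 'rV[R]_n) :
  convex_set (K : set (convex_lmodType 'rV[R]_n)) ->
  {within K `*` K, continuous (uncurry c)} ->
  {within disjoint_double K, continuous f} ->
  K x ->
  let f1 := first_copy f in
  let f2 := second_copy f in
  [<->
    (forall (xs : 'I_n.+1 -> 'rV[R]_n) (lam : 'I_n.+1 -> R),
       (forall i, K (xs i)) ->
       (forall i, 0 <= lam i) ->
       \sum_i lam i = 1 ->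
       x = \sum_i lam i *: xs i ->
       f1 x - \sum_i lam i * f2 (xs i)
         <= \sum_i lam i * c (\sum_j lam j *: xs j) (xs i));
    (exists gamma : 'rV[R]_n, forall y : 'rV[R]_n,
       K y -> minimal_face K x y ->
       f1 x - f2 y <= c x y + dotp gamma (y - x));
    (forall (d : measure_display) (T : measurableType d)
            (P : probability T R) (X : {RV P >-> borel_rV R n}),
       bounded_set (range (X : T -> 'rV[R]_n)) ->
       (forall w, K (X w)) ->
       has_barycentre P X x ->
       has_expectation P (fun w => f1 x - f2 (X w)) ->
       has_expectation P (fun w => c x (X w)) ->
       ('E_P[fun w => (f1 x - f2 (X w))%R] <= 'E_P[fun w => c x (X w)])%E)
  ].
Proof.
move=> convK cc cf Kx f1 f2.
have ccx : {within K, continuous (c x)}.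
  apply: (within_continuous_precomp (g := pair x)) cc => //= y.
  apply: (@cvg_pair _ _ _ (nbhs y) (nbhs x) (nbhs y) _ _ _ (cst x) id);
    [exact: cvg_cst|exact: cvg_id].
have cf2 : {within K, continuous f2}.
  apply: (within_continuous_precomp (g := existT _ true)) cf => //.
  exact: existT_continuous.
tfae.
- move=> Hi; have [|gamma Hg] :=
    @supporting_functional _ _ _ convK (fun y => c x y + f2 y - f1 x) x Kx.
    move=> xs lam Kxs lam0 lam1 xE; have := Hi xs lam Kxs lam0 lam1 xE.
    rewrite -xE; under [X in _ -> 0 <= X]eq_bigr do rewrite mulrBr mulrDr.
    by rewrite sumrB big_split/= -mulr_suml lam1; lra.
  by exists gamma => y _ /Hg; lra.
- move=> [gamma Hg] d T P X bndX KX Xx exY exZ.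
  apply: (le_expectation_perturbed (G := fun w => dotp gamma (X w - x))) => //.
  + by apply: measurable_funB => //; exact: measurable_within_comp cf2 KX.
  + exact: measurable_within_comp ccx KX.
  + exact: integrable_dotp.
  + exact: integral_dotp.
  + by apply: filterS (ae_minimal_face convK Kx bndX KX Xx) => w; exact: Hg.
- move=> Hiii xs lam Kxs lam0 lam1 xE; rewrite -xE.
  (* [X0] takes the value [xs i] with weight [lam i]. Each [k > n] carries no mass, and the default
     of [inord] still keeps [X0 k] in [K]. *)
  pose X0 (k : nat) : borel_rV R n := xs (inord k).
  have mX0 : measurable_fun setT X0 by [].
  pose P := finite_law lam0 lam1.
  pose X : {RV P >-> borel_rV R n} := mfun_Sub (mem_set mX0).
  have := Hiii _ _ P X.
  rewrite !expectation_finite_law lee_fin /= /X0.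
  under eq_bigr do rewrite inord_val mulrBr.
  rewrite sumrB -mulr_suml lam1 mul1r.
  have -> : \sum_(i < n.+1) lam i * c x (xs (inord i)) =
      \sum_i lam i * c x (xs i) by apply: eq_bigr => i _; rewrite inord_val.
  apply.
  + exists (\sum_i `|xs i|); split; first exact: num_real.
    move=> M ltM _ [k _ <-]; apply: le_trans (ltW ltM).
    by rewrite (bigD1 (inord k))//= lerDl sumr_ge0.
  + by move=> k; exact: Kxs.
  + move=> i; rewrite expectation_finite_law; congr EFin.
    rewrite xE summxE; apply: eq_bigr => j _.
    by rewrite mxE /X/= /X0 inord_val.
  + exact: has_expectation_finite_law.
  + exact: has_expectation_finite_law.
Qed.
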